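(* Let $p$ be a prime, let $d\ge 2$, and let $P^\perp$ and $Q^\perp$ be linear cellular automaton shifts over $\mathbb F_p$ in $d$ variables, given by $P=X_d-\Phi(X_1,\ldots,X_{d-1})$ and $Q=X_d-\Psi(X_1,\ldots,X_{d-1})$. Then every topological homomorphism $\phi\colon P^\perp\to Q^\perp$ is algebraic (i.e. is a homomorphism of $\mathbb F_p[X_1^{\pm1},\ldots,X_d^{\pm1}]$-modules). Moreover, $P^\perp$ and $Q^\perp$ are topologically isomorphic if and only if $P^\perp=Q^\perp$.
   Context: Identify $(c_{\mathbf n})_{\mathbf n\in\mathbb Z^d}\in\mathbb F_p^{\mathbb Z^d}$ with the formal (two-sided) Laurent series $\sum_{\mathbf n\in\mathbb Z^d}c_{\mathbf n}X^{\mathbf n}$, where $X^{\mathbf n}=X_1^{n_1}\cdots X_d^{n_d}$. The set $\mathbb F_p[[X_1^{\pm1},\ldots,X_d^{\pm1}]]$ of all such series, with the product topology ($\mathbb F_p$ discrete), is a compact abelian group and a module over the ring $\mathbb F_p[X_1^{\pm1},\ldots,X_d^{\pm1}]$ of Laurent polynomials. The group $\mathbb Z^d$ acts by $T_{\mathbf n}x=X^{\mathbf n}x$; the shift $\sigma_i$ is multiplication by $X_i^{-1}$. For a Laurent polynomial $P$, $P^\perp=\{x\in\mathbb F_p[[X_1^{\pm1},\ldots,X_d^{\pm1}]]: Px=0\}$, a closed submodule. $P^\perp$ is a linear cellular automaton shift if $P=X_d-\Phi(X_1,\ldots,X_{d-1})$, where $\Phi$ is a Laurent polynomial in $X_1,\ldots,X_{d-1}$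 over $\mathbb F_p$ with at least two non-zero terms. A homomorphism $\phi\colon P^\perp\to Q^\perp$ is a $\mathbb Z^d$-equivariant map (i.e. commuting with all $\sigma_i$) with $\phi(0)=0$; it is not assumed additive. It is a topological homomorphism if it is continuous, and an algebraic homomorphism if it is a module homomorphism. $P^\perp$ and $Q^\perp$ are topologically isomorphic if there is a homeomorphism $P^\perp\to Q^\perp$ commuting with all $\sigma_i$. *)

(* Defs.v *)
From HB Require Import structures.
From mathcomp Require Import all_boot all_algebra finmap.
From mathcomp Require Import all_classical topology.
From mathcomp Require Import monalg.

Set Implicit Arguments.
Unset Strict Implicit.
Unset Printing Implicit Defensive.

Import GRing.Theory.

Local Open Scope classical_set_scope.
Local Open Scope ring_scope.

(* Laurent polynomials as finitely supported functions Z^d -> F_p. [monalg]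
   only multiplies over monoids without nontrivial units, which excludes Z^d,
   so only its additive structure is reused and the product is defined below. *)
Definition laurent (p d : nat) : Type := {malg 'F_p['rV[int]_d]}.

(* [x n] is the coefficient of X^n in the two-sided Laurent series [x]. *)
Definition series (p d : nat) : Type :=
  {ptws 'rV[int]_d -> discrete_topology 'F_p}.

HB.instance Definition _ p d := GRing.Zmodule.copy (laurent p d)
  {malg 'F_p['rV[int]_d]}.
HB.instance Definition _ p d := Topological.copy (series p d)
  {ptws 'rV[int]_d -> discrete_topology 'F_p}.
HB.instance Definition _ p d := GRing.Zmodule.copy (series p d)
  ('rV[int]_d -> 'F_p).

Definition monomial (p d : nat) (n : 'rV[int]_d) : laurent p d := << 1 *g n >>.

(* Both operations are locked because unification otherwise unfolds the sums. *)
HB.lock Definition laurent_mul (p d : nat) (f g : laurent p d) : laurent p d :=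
  \sum_(k <- msupp f) \sum_(l <- msupp g) << f@_k * g@_l *g k + l >>.

HB.lock Definition laurent_act (p d : nat) (f : laurent p d) (x : series p d) :
    series p d :=
  fun n => \sum_(k <- msupp f) f@_k * x (n - k).

Arguments monomial p {d} n.

Section LaurentRing.
Context (p d : nat).
Implicit Types (f g h : laurent p d) (x y : series p d) (n k : 'rV[int]_d).
Notation monomial := (@monomial p d).
Notation laurent_mul := (@laurent_mul p d).
Notation laurent_act := (@laurent_act p d).

Lemma laurent_actEw (D : {fset 'rV[int]_d}) f x n : (msupp f `<=` D)%fset ->
  laurent_act f x n = \sum_(k <- D) f@_k * x (n - k).
Proof.
move=> fD; rewrite unlock; apply: big_fset_incl => // k _ kf.
by rewrite mcoeff_outdom// mul0r.
Qed.

Lemma laurent_actDl x f g :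
  laurent_act (f + g) x = laurent_act f x + laurent_act g x.
Proof.
apply/funext => n.
rewrite (@laurent_actEw (msupp f `|` msupp g)%fset); last exact: msuppD_le.
rewrite -[RHS]/(laurent_act f x n + laurent_act g x n).
rewrite (@laurent_actEw (msupp f `|` msupp g)%fset f) ?fsubsetUl//.
rewrite (@laurent_actEw (msupp f `|` msupp g)%fset g) ?fsubsetUr//.
by rewrite -big_split; apply: eq_bigr => k _; rewrite mcoeffD mulrDl.
Qed.

Lemma laurent_act0l x : laurent_act 0 x = 0.
Proof. by apply/funext => n; rewrite unlock msupp0 big_seq_fset0. Qed.

Lemma laurent_act_suml (I : Type) (r : seq I) (F : I -> laurent p d) x :
  laurent_act (\sum_(i <- r) F i) x = \sum_(i <- r) laurent_act (F i) x.
Proof.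
elim: r => [|i r IH]; first by rewrite !big_nil laurent_act0l.
by rewrite !big_cons laurent_actDl IH.
Qed.

Lemma laurent_actUl (c : 'F_p) k x :
  laurent_act << c *g k >> x = fun n => c * x (n - k).
Proof.
apply/funext => n; rewrite (@laurent_actEw [fset k]%fset) ?msuppU_le//.
by rewrite big_seq_fset1 mcoeffUU.
Qed.

Lemma series_sumE (I : Type) (r : seq I) (F : I -> series p d) n :
  (\sum_(i <- r) F i) n = \sum_(i <- r) F i n.
Proof. by elim: r => [|i r IH]; rewrite ?big_nil// !big_cons -IH. Qed.

Lemma laurent_actA f g x :
  laurent_act f (laurent_act g x) = laurent_act (laurent_mul f g) x.
Proof.
rewrite laurent_mul.unlock laurent_act_suml; apply/funext => n.
rewrite series_sumE (@laurent_actEw (msupp f))//; apply: eq_bigr => k _.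
rewrite laurent_act_suml series_sumE.
rewrite (@laurent_actEw (msupp g))// mulr_sumr; apply: eq_bigr => l _.
by rewrite laurent_actUl opprD addrA mulrA.
Qed.

Lemma laurent_actDr f : {morph laurent_act f : x y / x + y}.
Proof.
move=> x y; apply/funext => n.
rewrite -[RHS]/(laurent_act f x n + laurent_act f y n) unlock -big_split.
by apply: eq_bigr => k _; exact: mulrDr.
Qed.

Lemma laurent_act1 x : laurent_act (monomial 0) x = x.
Proof.
by rewrite laurent_actUl; apply/funext => n; rewrite subr0 mul1r.
Qed.

Lemma laurent_act_inj f g : (forall x, laurent_act f x = laurent_act g x) ->
  f = g.
Proof.
have E h k : laurent_act h (fun n => (n == 0)%:R) k = h@_k.
  rewrite (@laurent_actEw (k |` msupp h)%fset) ?fsubsetUr//.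
  rewrite (big_fsetD1 k) ?fset1U1//= subrr eqxx mulr1 big1_fset ?addr0// => l.
  by rewrite !inE subr_eq0 eq_sym => /andP[/negPf -> _] _; rewrite mulr0.
by move=> fg; apply/malgP => k; rewrite -!E fg.
Qed.

Lemma laurent_mulA : associative laurent_mul.
Proof.
move=> f g h; apply: laurent_act_inj => x.
transitivity (laurent_act f (laurent_act g (laurent_act h x))).
  by rewrite (laurent_actA g h x) (laurent_actA f (laurent_mul g h) x).
by rewrite -(laurent_actA (laurent_mul f g) h x) -(laurent_actA f g (laurent_act h x)).
Qed.

Lemma laurent_mulC : commutative laurent_mul.
Proof.
move=> f g; rewrite unlock exchange_big; apply: eq_bigr => k _.
by apply: eq_bigr => l _; rewrite mulrC addrC.
Qed.

Lemma laurent_mul1 : left_id (monomial 0) laurent_mul.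
Proof.
by move=> f; apply: laurent_act_inj => x; rewrite -laurent_actA laurent_act1.
Qed.

Lemma laurent_mulDl : left_distributive laurent_mul +%R.
Proof.
move=> f g h; apply: laurent_act_inj => x.
rewrite laurent_actDl -(laurent_actA (f + g)) -(laurent_actA f h).
by rewrite -(laurent_actA g h) laurent_actDl.
Qed.

Lemma laurent_one_neq0 : monomial 0 != 0.
Proof. by rewrite /monomial monalgU_eq0 oner_eq0. Qed.

HB.instance Definition _ := GRing.Zmodule_isComNzRing.Build (laurent p d)
  laurent_mulA laurent_mulC laurent_mul1 laurent_mulDl laurent_one_neq0.

HB.instance Definition _ := GRing.Zmodule_isLmodule.Build (laurent p d)
  (series p d) laurent_actA laurent_act1 laurent_actDr
  (fun x f g => laurent_actDl x f g).

Definition perp (P : laurent p d) : set (series p d) := [set x | P *: x = 0].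

Lemma perp_submod (P : laurent p d) : submod_closed (fun x => x \in perp P).
Proof.
split=> [|f x y /set_mem Px /set_mem Py]; apply/mem_set; rewrite /perp /=.
  by rewrite scaler0.
by rewrite scalerDr scalerA mulrC -scalerA Px Py scaler0 addr0.
Qed.

(* [set_type (perp P)] already carries the subspace topology; these instances
   add the submodule structure, so [perp P] as a type has both. *)
HB.instance Definition _ (P : laurent p d) :=
  SubChoice.copy (set_type (perp P)) {x | x \in perp P}.
HB.instance Definition _ (P : laurent p d) :=
  @GRing.SubChoice_isSubLmodule.Build (laurent p d) (series p d) _
    (set_type (perp P)) (perp_submod P).
End LaurentRing.

(* sigma_i is multiplication by X_i^-1, that is (sigma_i x)_n = x_(n + e_i). *)
Definition shift (p d : nat) (V : lmodType (laurent p d)) (i : 'I_d) (x : V)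
    : V :=
  monomial p (- delta_mx 0 i) *: x.

Section Homomorphisms.
Context (p d : nat) (P Q : laurent p d).

Definition homomorphism (phi : perp P -> perp Q) : Prop :=
  (forall i, {morph phi : x / shift i x}) /\ phi 0 = 0.

Definition topological_homomorphism (phi : perp P -> perp Q) : Prop :=
  homomorphism phi /\ continuous phi.

Definition algebraic_homomorphism (phi : perp P -> perp Q) : Prop :=
  homomorphism phi /\ linear phi.

Definition topologically_isomorphic : Prop :=
  exists (phi : perp P -> perp Q) (psi : perp Q -> perp P),
    [/\ cancel phi psi, cancel psi phi, continuous phi, continuous psi
      & forall i, {morph phi : x / shift i x}].
End Homomorphisms.

(* In d + 1 variables, the last one, indexed by ord_max, is singled out;
   [lift_laurent] views a polynomial in the first d variables as a polynomial
   in all d + 1. *)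
Definition lift_exponent (d : nat) (k : 'rV[int]_d) : 'rV[int]_d.+1 :=
  \row_i oapp (k 0) 0 (unlift ord_max i).

Definition lift_laurent (p d : nat) (Phi : laurent p d) : laurent p d.+1 :=
  \sum_(k <- msupp Phi) << Phi@_k *g lift_exponent k >>.

Definition ca_poly (p d : nat) (Phi : laurent p d) : laurent p d.+1 :=
  monomial p (delta_mx 0 ord_max) - lift_laurent Phi.

Definition at_least_two_terms (p d : nat) (Phi : laurent p d) : Prop :=
  (1 < #|` msupp Phi|)%N.

(* Main.v *)
Require Import Defs.
From HB Require Import structures.
From mathcomp Require Import all_boot all_algebra finmap finfield zify.
From mathcomp Require Import all_classical topology.
From mathcomp Require Import monalg.

Set Implicit Arguments.
Unset Strict Implicit.
Unset Printing Implicit Defensive.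

Import GRing.Theory.

Local Open Scope classical_set_scope.
Local Open Scope ring_scope.

(** The proof rests on the Frobenius identity
    L^(p^k) = \sum_m L_m X^(p^k m),
    valid for every Laurent polynomial L over F_p.

    Let L and M be Laurent polynomials in which X_i does not occur, and let phi
    map the shift of X_i - L to the shift of X_i - M, continuously,
    equivariantly and with phi 0 = 0. By compactness a coordinate of phi x
    depends on finitely many coordinates of x ([continuous_uniform]). On the
    shift of X_i - L multiplication by X_i is multiplication by L, so the layer
    n_i = 0 of x determines the layers n_i < 0. Hence, for a suitable v, the
    coordinate h(x) = (phi x)_v depends only on the restriction of x to a finite
    window W of the layer n_i = 0 ([continuous_local]).

    Apply phi to X_i^q x = L^q x with q = p^k and read the coordinate v. By the
    Frobenius identity this gives
    h(\sum_m L_m X^(q m) x) = \sum_m M_m h(X^(q m) x).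
    For large q the translates W - q m are pairwise disjoint, and the restriction
    of x to a finite part of the layer n_i = 0 is arbitrary ([perp_extend]), so
    h(\sum_m L_m a_m) = \sum_m M_m h(a_m)
    for all choices of points a_m, where m ranges over the supports of L and M
    ([local_rule_identity]). Taking all a_m but one equal to 0 gives
    h(L_m a) = M_m h(a). Since L has two non-zero coefficients, h is then
    additive, hence so is phi, and phi is linear. If moreover h(a) <> 0 for some a, then L_m = M_m for every m, that is L = M.

    An isomorphism need not fix 0, but phi - phi 0 satisfies all the hypotheses
    above and is not 0, so L = M. *)

(** * Laurent polynomials acting on series *)

Section LaurentAction.
Context (p d : nat).
Implicit Types (f g L : laurent p d) (x y : series p d) (n m : 'rV[int]_d).

Lemma series_addE x y n : (x + y) n = x n + y n. Proof. by []. Qed.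

Lemma scale_laurentEw (D : {fset 'rV[int]_d}) f x n :
  (msupp f `<=` D)%fset -> (f *: x) n = \sum_(k <- D) f@_k * x (n - k).
Proof. exact: laurent_actEw. Qed.

Lemma scale_termE (c : 'F_p) m x n :
  ((<< c *g m >> : laurent p d) *: x) n = c * x (n - m).
Proof. exact: (congr1 (fun z : series p d => z n) (laurent_actUl c m x)). Qed.

Lemma scale_monomialE m x n : (monomial p m *: x) n = x (n - m).
Proof. by rewrite [LHS]scale_termE mul1r. Qed.

Lemma scale_sumE (I : Type) (r : seq I) (F : I -> laurent p d) x n :
  ((\sum_(j <- r) F j) *: x) n = \sum_(j <- r) (F j *: x) n.
Proof. by rewrite scaler_suml series_sumE. Qed.

Lemma laurent_termM (c c' : 'F_p) m n :
  (<< c *g m >> : laurent p d) * << c' *g n >> = << c * c' *g m + n >>.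
Proof.
apply: laurent_act_inj => x; apply/funext => k.
rewrite -[LHS]/((((<< c *g m >> : laurent p d) * << c' *g n >>) *: x) k).
rewrite -[RHS]/(((<< c * c' *g m + n >> : laurent p d) *: x) k).
by rewrite -scalerA !scale_termE opprD addrA mulrA.
Qed.

Lemma monomialD m n : monomial p (m + n) = monomial p m * monomial p n.
Proof. by rewrite /monomial laurent_termM mulr1. Qed.

Lemma scale_monomialD m n x :
  monomial p (m + n) *: x = monomial p m *: (monomial p n *: x).
Proof. by rewrite monomialD scalerA. Qed.

Lemma laurent_termX (c : 'F_p) m k :
  (<< c *g m >> : laurent p d) ^+ k = << c ^+ k *g m *+ k >>.
Proof.
elim: k => [|k IH]; first by rewrite !expr0 mulr0n.
by rewrite !exprS IH laurent_termM mulrS.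
Qed.

Hypothesis p_prime : prime p.

Lemma pchar_laurent : p \in [pchar (laurent p d)].
Proof.
rewrite inE p_prime /=; apply/eqP.
rewrite -[1]/(<< 1 *g 0 >> : laurent p d) -monalgUMn.
by rewrite pchar_Fp_0 // monalgU0.
Qed.

Lemma Fp_frobenius (c : 'F_p) : c ^+ p = c.
Proof. by have := expf_card c; rewrite card_Fp. Qed.

Lemma laurent_frobenius L k :
  L ^+ (p ^ k) = \sum_(m <- msupp L) << L@_m *g m *+ (p ^ k) >>.
Proof.
elim: k => [|k IH]; first by rewrite expn0 expr1 {1}[L]monalgE.
rewrite expnSr exprM IH -(pFrobenius_autE pchar_laurent) rmorph_sum.
apply: eq_bigr => m _; rewrite /= pFrobenius_autE laurent_termX.
by rewrite Fp_frobenius mulrnA.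
Qed.

Lemma scale_frobeniusE (D : {fset 'rV[int]_d}) L k x n :
  (msupp L `<=` D)%fset ->
  (L ^+ (p ^ k) *: x) n = \sum_(m <- D) L@_m * x (n - m *+ (p ^ k)).
Proof.
move=> LD; rewrite laurent_frobenius scale_sumE.
under eq_bigr do rewrite scale_termE.
by apply: big_fset_incl => // m _ mL; rewrite mcoeff_outdom// mul0r.
Qed.

End LaurentAction.

(** * Cylinders and compactness *)

Section SeriesTopology.
Context (p d : nat).
Implicit Types (x y : series p d).

Lemma nbhs_cylinder (D : seq 'rV[int]_d) x :
  nbhs x [set y : series p d | {in D, y =1 x}].
Proof.
elim: D => [|n D IH]; first by apply: filterS filterT => y _ k.
have nx : nbhs x [set y : series p d | y n = x n].
  have := @proj_continuous _ (fun=> discrete_topology 'F_p) n x.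
  by move=> /(_ [set x n]); apply; exact: discrete_set1.
apply: filterS (filterI nx IH) => y [/= yn yD] k; rewrite inE.
by case/predU1P => [->//|/yD].
Qed.

(** Conversely, the cylinders form a basis of neighborhoods. *)
Lemma cylinder_nbhs x (A : set (series p d)) : nbhs x A ->
  exists D : seq 'rV[int]_d, forall y, {in D, y =1 x} -> A y.
Proof.
pose B (D : seq 'rV[int]_d) := [set y : series p d | {in D, y =1 x}].
pose F := filter_from setT B.
have FF : Filter F.
  apply: filter_from_filter; first by exists [::].
  move=> D D' _ _; exists (D ++ D') => // y yD.
  by split=> k kD; apply: yD; rewrite mem_cat kD ?orbT.
have : F --> x.
  apply/cvg_sup => n U [V [[W] oW <-] Wx VU].
  by exists [:: n] => // y /(_ n (mem_head _ _)) yn; apply: VU; rewrite /= yn.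
by move=> + xA => /(_ A xA) [D _ DA]; exists D.
Qed.

Lemma series_compact : compact [set: series p d].
Proof.
have := @tychonoff _ (fun _ : 'rV[int]_d => discrete_topology 'F_p) (fun=> setT).
rewrite (_ : [set f | _] = setT); last by apply/seteqP; split.
by apply=> n; apply: finite_compact; apply: finite_finset.
Qed.

(** Sequential form of compactness: some point agrees on every finite set with
    terms of arbitrarily large index. *)
Lemma series_cluster (u : nat -> series p d) :
  exists x : series p d, forall (D : seq 'rV[int]_d) K,
    exists2 k, (K <= k)%N & {in D, u k =1 x}.
Proof.
have [x [_ ux]] := @series_compact (u @ \oo) _ filterT.
exists x => D K.
have [|y [[k /= Kk <-] kD]] := ux [set u k | k in [set k | (K <= k)%N]] _ _
  (nbhs_cylinder D x).
  by exists K => // k Kk; exists k.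
by exists k.
Qed.

End SeriesTopology.

(** * Separation of finite windows *)

Lemma near_in (T : eqType) (s : seq T) (F : set_system nat) (P : T -> nat -> Prop) :
  Filter F -> {in s, forall t, \forall k \near F, P t k} ->
  \forall k \near F, {in s, forall t, P t k}.
Proof.
move=> FF; elim: s => [|t s IH] sP; first by apply: filterS filterT => k _ ?.
have sP' : \forall k \near F, {in s, forall t, P t k}.
  by apply: IH => t' t's; apply: sP; rewrite inE t's orbT.
apply: filterS (filterI (sP t (mem_head _ _)) sP') => k [Pt Ps] t'.
by rewrite inE => /predU1P[->|/Ps].
Qed.

Lemma eq_int_progression (a a' : int) (q : nat) (b b' : int) :
  (`|(a - a')%R| < q)%N -> a - b *+ q = a' - b' *+ q -> b = b'.
Proof.
rewrite -[b *+ q]mulr_natr -[b' *+ q]mulr_natr !natz => aq E; apply/eqP/negPn/negP => bb'.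
have : a - a' = (b - b') * q%:Z by rewrite mulrBl; lia.
move/(congr1 absz); rewrite abszM absz_nat => Eq.
have ab0 : (0 < `|(b - b')%R|)%N by lia.
by have := leq_pmull q ab0; rewrite -Eq leqNgt aq.
Qed.

(** If p^k is large, the translates D - p^k m, for m in S, are pairwise
    disjoint. *)
Lemma near_separated (p d : nat) (S D : seq 'rV[int]_d) : (1 < p)%N ->
  \forall k \near \oo, {in S, forall m, {in S, forall m', {in D, forall n,
    {in D, forall n', n - m *+ (p ^ k) = n' - m' *+ (p ^ k) -> m = m'}}}}.
Proof.
move=> p_gt1; apply: near_in => m _; apply: near_in => m' _.
apply: near_in => n _; apply: near_in => n' _.
have [->|/eqP mm'] := eqVneq m m'; first by apply: filterS filterT.
have [j mj] : exists j, m 0 j <> m' 0 j.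
  apply: contrapT => H; apply: mm'; apply/rowP => j.
  by apply: contrapT => mj; apply: H; exists j.
exists `|(n 0 j - n' 0 j)%R|%N => // k Kk E; case: mj.
apply: (@eq_int_progression (n 0 j) (n' 0 j) (p ^ k)).
  exact: leq_ltn_trans Kk (ltn_expl k p_gt1).
by have /rowP/(_ j) := E; rewrite !mxE !mulmxnE.
Qed.
(** * The shift of X_i - L, where X_i does not occur in L *)

Section AutomatonShift.
Context (p d : nat) (i : 'I_d).
Implicit Types (f L M : laurent p d) (x y : series p d) (n m : 'rV[int]_d).
Local Notation e := (delta_mx 0 i : 'rV[int]_d).

(** Multiplication by a Laurent polynomial is a finite-window rule. *)
Lemma eq_scale f x y n :
  {in [seq n - k | k <- msupp f], x =1 y} -> (f *: x) n = (f *: y) n.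
Proof.
move=> xy; rewrite !(@scale_laurentEw _ _ (msupp f)) //.
by apply: eq_big_seq => k kf; rewrite xy //; apply/mapP; exists k.
Qed.

Lemma perp_closed f x :
  (forall n (D : seq 'rV[int]_d), exists2 y : series p d, (f *: y) n = 0 & {in D, y =1 x}) ->
  perp f x.
Proof.
move=> H; apply/funext => n.
have [y fy yx] := H n [seq n - k | k <- msupp f].
by rewrite -[RHS]/(0 : 'F_p) -fy; apply/esym/eq_scale.
Qed.

(** The variable X_i does not occur in L. *)
Definition free_of L : Prop := {in msupp L, forall m, m 0 i = 0}.

(** The polynomial X_i - L. The distinguished variable X_i is arbitrary, not
    necessarily the last one. *)
Definition automaton L : laurent p d := monomial p e - L.

Lemma perp_automatonP L x :
  perp (automaton L) x <-> monomial p e *: x = L *: x.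
Proof.
rewrite /perp /= /automaton scalerBl; split => [/eqP|->]; last by rewrite subrr.
by rewrite subr_eq0 => /eqP.
Qed.

Lemma perp_automatonX L x q : perp (automaton L) x ->
  monomial p (e *+ q) *: x = L ^+ q *: x.
Proof.
move=> /perp_automatonP xL; elim: q => [|q IH]; first by rewrite expr0 mulr0n.
by rewrite mulrSr scale_monomialD xL scalerA mulrC -scalerA IH scalerA exprS.
Qed.

(** The series whose layer n_i = q - j is that of L^j w for j >= 0, moved from
    the layer n_i = 0, and whose layers n_i > q vanish. When w lives on the layer
    n_i = 0, it is the orbit of w under L, started at height q and running
    downwards. *)
Definition past_orbit L (w : series p d) (q : nat) : series p d := fun n =>
  if (n 0 i <= q%:Z)%R then (L ^+ `|(q%:Z - n 0 i)%R|%N *: w) (n - n 0 i *: e)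
  else 0.

Lemma past_orbitE L w q n : free_of L -> (n 0 i <= q%:Z)%R ->
  (automaton L *: past_orbit L w q) n = 0.
Proof.
move=> Lfree nq; rewrite /automaton scalerBl.
rewrite -[LHS]/((_ *: past_orbit L w q) n - (_ *: past_orbit L w q) n).
apply/eqP; rewrite subr_eq0 scale_monomialE; apply/eqP.
rewrite (@scale_laurentEw _ _ (msupp L)) //.
rewrite /past_orbit !mxE !eqxx /= ifT; last by lia.
rewrite (_ : `|_|%N = `|(q%:Z - n 0 i)%R|%N.+1); last by lia.
rewrite exprS -scalerA (@scale_laurentEw _ _ (msupp L)) //.
apply: eq_big_seq => m mL; rewrite !mxE (Lfree m) // subr0 nq.
have -> : n - e - (n 0 i - 1) *: e - m = n - m - n 0 i *: e => //.
by rewrite scalerBl scale1r opprB addrA subrK addrAC.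
Qed.

(** The restriction of a point of the shift to a finite part of the layer
    n_i = 0 is arbitrary. With m0 in the support of L, start the orbit under L of
    L_m0^-1 X^(- p^k m0) y at height p^k, where y is first set to 0 outside D.
    Its layer n_i = 0 is y plus multiples of translates of y that leave every
    finite set as k grows, and it satisfies the equation of the shift up to
    height p^k. Any cluster point of these series solves the problem. *)
Lemma perp_extend L (D : seq 'rV[int]_d) y : prime p -> L != 0 -> free_of L ->
  {in D, forall n, n 0 i = 0} ->
  exists2 x, perp (automaton L) x & {in D, x =1 y}.
Proof.
move=> p_prime L0 Lfree D0.
have /fset0Pn[m0 m0L] : msupp L != fset0.
  by apply: contraNneq L0 => L0; rewrite [L]monalgE L0 big_seq_fset0.
set c := L@_m0.
have c0 : c != 0 by rewrite mcoeff_neq0.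
pose w k : series p d :=
  fun n => c^-1 * (if n + m0 *+ (p ^ k) \in D then y (n + m0 *+ (p ^ k)) else 0).
have [x xP] := series_cluster (fun k => past_orbit L (w k) (p ^ k)).
exists x.
  apply: perp_closed => n D'; have [k nk kx] := xP D' `|(n 0 i)%R|%N.
  exists (past_orbit L (w k) (p ^ k)) => //; apply: past_orbitE => //.
  have := ltn_expl k (prime_gt1 p_prime); lia.
have [K _ sepK] := near_separated (msupp L) D (prime_gt1 p_prime).
have [k Kk kx] := xP D K => n nD; rewrite -kx //.
rewrite /past_orbit D0 // scale0r !subr0 absz_nat.
rewrite (scale_frobeniusE p_prime _ _ _ (fsubset_refl _)).
rewrite (big_fsetD1 m0) //= big1_fset => [|m]; last first.
  rewrite !inE => /andP[mm0 mL] _; rewrite /w.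
  case: ifP => [inD|]; last by rewrite !mulr0.
  case/negP: mm0; apply/eqP/esym.
  by apply: (sepK k Kk _ m0L _ mL _ inD _ nD); rewrite addrK.
by rewrite /w subrK nD mulVKf // addr0.
Qed.

(** The values on W of a point of the shift determine its value at n. *)
Definition determines L (W : seq 'rV[int]_d) n : Prop :=
  forall x y, perp (automaton L) x -> perp (automaton L) y ->
    {in W, x =1 y} -> x n = y n.

Lemma common_window L (D : seq 'rV[int]_d) :
  {in D, forall n, exists2 W : seq 'rV[int]_d,
    {in W, forall m, m 0 i = 0} & determines L W n} ->
  exists2 W : seq 'rV[int]_d,
    {in W, forall m, m 0 i = 0} & {in D, forall n, determines L W n}.
Proof.
elim: D => [|n D IH] DW; first by exists [::].
have [|W W0 WP] := IH; first by move=> m mD; apply: DW; rewrite inE mD orbT.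
have [W' W'0 W'P] := DW n (mem_head _ _).
exists (W' ++ W) => [m|m mD x y xL yL xy].
  by rewrite mem_cat => /orP[/W'0|/W0].
have sub (V : seq 'rV[int]_d) : {subset V <= W' ++ W} -> {in V, x =1 y} by move=> sV k /sV /xy.
have W's : {subset W' <= W' ++ W} by move=> k kW; rewrite mem_cat kW.
have Ws : {subset W <= W' ++ W} by move=> k kW; rewrite mem_cat kW orbT.
move: mD; rewrite inE => /predU1P[->|mD]; first exact: (W'P x y xL yL (sub _ W's)).
exact: (WP m mD x y xL yL (sub _ Ws)).
Qed.

Lemma perp_determined L n : free_of L -> (n 0 i <= 0)%R ->
  exists2 W : seq 'rV[int]_d, {in W, forall m, m 0 i = 0} & determines L W n.
Proof.
move=> Lfree n_le0; have [j] : exists j : nat, n 0 i = - j%:Z.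
  by exists `|(n 0 i)%R|%N; lia.
elim: j n {n_le0} => [|j IH] n nj.
  exists [:: n] => [m|x y _ _]; first by rewrite inE => /eqP->; lia.
  by apply; rewrite mem_head.
have [|W W0 WP] := @common_window L [seq n + e - k | k <- msupp L].
  move=> _ /mapP[k kL ->]; apply: IH.
  by rewrite !mxE !eqxx (Lfree k) //= subr0 nj; lia.
exists W => // x y xL yL xy.
have rec z : perp (automaton L) z -> z n = (L *: z) (n + e).
  by move=> /perp_automatonP <-; rewrite scale_monomialE addrK.
by rewrite !rec //; apply: eq_scale => k /WP; apply.
Qed.

End AutomatonShift.

(** * Continuous maps are given by finite windows *)

Section PerpTopology.
Context (p d : nat).
Implicit Types (f g : laurent p d).

Lemma cylinder_nbhs_perp f (X : perp f) (A : set (perp f)) : nbhs X A ->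
  exists D : seq 'rV[int]_d, forall Y : perp f, {in D, val Y =1 val X} -> A Y.
Proof.
rewrite nbhsE => -[_ [[B oB <-] BX] BA].
have [D DB] := cylinder_nbhs (open_nbhs_nbhs (conj oB BX)).
by exists D => Y /DB BY; apply: BA.
Qed.

Lemma nbhs_cylinder_perp f (X : perp f) (D : seq 'rV[int]_d) :
  nbhs X [set Y : perp f | {in D, val Y =1 val X}].
Proof.
have := nbhs_cylinder D (val X); rewrite !nbhsE => -[B [oB BX] BD].
by exists (val @^-1` B) => [|Y /BD //]; split => //; exists B.
Qed.

Lemma perp_eval_continuous f g (phi : perp f -> perp g) (X : perp f) n :
  continuous phi -> nbhs X [set Y : perp f | val (phi Y) n = val (phi X) n].
Proof.
move=> phiC.
have XC : nbhs X (phi @^-1` [set Y : perp g | {in [:: n], val Y =1 val (phi X)}]).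
  exact: phiC (nbhs_cylinder_perp (phi X) [:: n]).
by apply: filterS XC => Y /(_ n (mem_head _ _)).
Qed.

(** Each coordinate of a continuous map depends on finitely many coordinates of
    its argument, by compactness of the domain. *)
Lemma continuous_uniform f g (phi : perp f -> perp g) n : continuous phi ->
  exists D : seq 'rV[int]_d, forall X Y : perp f,
    {in D, val X =1 val Y} -> val (phi X) n = val (phi Y) n.
Proof.
move=> phiC; apply: contrapT => noD.
(* The box k exhaust the countable set of exponents. *)
pose box k : seq 'rV[int]_d := pmap choice.unpickle (iota 0 k).
have /choice[u uP] k : exists XY : perp f * perp f,
    {in box k, val XY.1 =1 val XY.2} /\ val (phi XY.1) n <> val (phi XY.2) n.
  apply: contrapT => H; apply: noD; exists (box k) => X Y XY.
  by apply: contrapT => phiXY; apply: H; exists (X, Y).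
have [x xP] := series_cluster (fun k => val (u k).1).
have xf : perp f x.
  apply: perp_closed => m D; have [k _ kx] := xP D 0%N.
  by exists (val (u k).1) => //; have /set_mem -> := valP (u k).1.
pose X : perp f := exist _ x (mem_set xf).
have [D DX] := cylinder_nbhs_perp (perp_eval_continuous X n phiC).
pose K := (\max_(m <- D) choice.pickle m).+1.
have [k Kk kx] := xP D K; have [u12 phiu] := uP k.
have Dbox : {subset D <= box k}.
  move=> m mD; rewrite mem_pmap; apply/mapP; exists (choice.pickle m); last first.
    by rewrite choice.pickleK.
  rewrite mem_iota add0n; apply: leq_trans Kk; rewrite ltnS.
  exact: leq_bigmax_seq.
apply: phiu; rewrite (DX (u k).1) ?(DX (u k).2) // => m mD.
by rewrite -u12 ?Dbox // kx.
Qed.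

End PerpTopology.

Lemma int_row_ind (d : nat) (G : 'rV[int]_d -> Prop) : G 0 ->
  (forall m n, G m -> G n -> G (m + n)) -> (forall m, G m -> G (- m)) ->
  (forall j, G (delta_mx 0 j)) -> forall m, G m.
Proof.
move=> G0 GD GN Gdelta m.
have Gn n k : G n -> G (n *+ k).
  by move=> Gm; elim: k => [|k IH]; rewrite ?mulr0n // mulrS; apply: GD.
rewrite (row_sum_delta m); elim/big_ind: _ => // j _.
case: (m 0 j) => k; first by rewrite -[Posz k]natz scaler_nat; apply: Gn.
by rewrite NegzE -[Posz k.+1]natz scaleNr scaler_nat; apply: GN; apply: Gn.
Qed.

Lemma shift_monomial (p d : nat) (V V' : lmodType (laurent p d))
    (phi : V -> V') : (forall j, {morph phi : x / shift j x}) ->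
  forall m, {morph phi : x / monomial p m *: x}.
Proof.
have K (U : lmodType (laurent p d)) m (v : U) :
    monomial p (- m) *: (monomial p m *: v) = v.
  by rewrite scalerA -monomialD addNr -[monomial p 0]/(1 : laurent p d) scale1r.
have GN m : {morph phi : x / monomial p m *: x} ->
    {morph phi : x / monomial p (- m) *: x}.
  by move=> Gm x; rewrite -[in RHS](K _ (- m) x) opprK Gm K.
move=> phiS; apply: int_row_ind => [x|m n Gm Gn x|//|j x].
- by rewrite -[monomial p 0]/(1 : laurent p d) !scale1r.
- by rewrite !monomialD -!scalerA Gm Gn.
- by rewrite -[delta_mx 0 j]opprK; apply: GN; exact: phiS.
Qed.

Section Homomorphism.
Context (p d : nat) (i : 'I_d) (L : laurent p d) (Q : laurent p d).
Hypothesis Lfree : free_of i L.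
Local Notation P := (automaton i L).
Context (phi : perp P -> perp Q).
Local Notation e := (delta_mx 0 i : 'rV[int]_d).

(** The coordinate v of phi X depends only on the restriction of X to W. *)
Definition local_at (v : 'rV[int]_d) (W : seq 'rV[int]_d) : Prop :=
  forall X Y : perp P, {in W, val X =1 val Y} -> val (phi X) v = val (phi Y) v.

Lemma continuous_local : continuous phi ->
  (forall m, {morph phi : x / monomial p m *: x}) ->
  exists (v : 'rV[int]_d) (W : seq 'rV[int]_d),
    {in W, forall m : 'rV[int]_d, m 0 i = 0} /\ local_at v W.
Proof.
move=> phiC phiM; have [D DP] := continuous_uniform 0 phiC.
pose N := (\max_(m <- D) `|(m 0 i)%R|)%N.
(* Translating D by - N e moves it into the half-space where n_i <= 0. *)
pose v : 'rV[int]_d := - (e *+ N).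
have [|W W0 WP] := @common_window _ _ i L [seq n + v | n <- D].
  move=> _ /mapP[n nD ->]; apply: perp_determined => //.
  have : (`|(n 0 i)%R| <= N)%N.
    exact: (@leq_bigmax_seq 'rV[int]_d D xpredT
      (fun m => `|(m 0 i)%R|%N) n nD isT).
  by rewrite !mxE mulmxnE mxE !eqxx /= natz; lia.
exists v, W; split=> // X Y XY.
have phiv Z : val (phi Z) v = val (phi (monomial p (- v) *: Z)) 0.
  by rewrite phiM [in RHS]linearZ /= scale_monomialE opprK add0r.
rewrite !phiv; apply: DP => n nD; rewrite !linearZ /= !scale_monomialE opprK.
apply: (WP (n + v)) => //; first exact: map_f.
- exact: set_mem (valP X).
- exact: set_mem (valP Y).
Qed.

End Homomorphism.

(** * Rigidity of equivariant maps given by a finite window *)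

Section Rigidity.
Context (p d : nat) (p_prime : prime p) (i : 'I_d) (L M : laurent p d).
Hypotheses (Lfree : free_of i L) (Mfree : free_of i M) (L0 : L != 0).
Local Notation P := (automaton i L).
Local Notation Q := (automaton i M).
Context (phi : perp P -> perp Q).
Hypotheses (phiM : forall m, {morph phi : x / monomial p m *: x})
  (phi0 : phi 0 = 0).
Context (v : 'rV[int]_d) (W : seq 'rV[int]_d).
Hypotheses (W0 : {in W, forall m : 'rV[int]_d, m 0 i = 0})
  (phiW : local_at phi v W).
Local Notation e := (delta_mx 0 i : 'rV[int]_d).

(** The coordinate v of phi X, as a function of X. *)
Definition local_rule (X : perp P) : 'F_p := val (phi X) v.
Local Notation h := local_rule.

(** The constant Laurent polynomial c, through which F_p acts on series. *)
Definition const_laurent (c : 'F_p) : laurent p d := << c *g 0 >>.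
Local Notation const := const_laurent.

Lemma scale_constE c (x : series p d) n : (const c *: x) n = c * x n.
Proof. by rewrite scale_termE subr0. Qed.

Lemma val_scale (R : laurent p d) f (X : perp R) : val (f *: X) = f *: val X.
Proof. exact: linearZ. Qed.

Lemma val_sum (R : laurent p d) (I : Type) (r : seq I) (F : I -> perp R) n :
  (val (\sum_(j <- r) F j)) n = \sum_(j <- r) val (F j) n.
Proof. by rewrite (raddf_sum val) series_sumE. Qed.

(** The central identity. Choose x in the shift whose translate X^(q m) x agrees
    with A m on W for every m in S, where q = p^k is large, and compare
    phi (L^q x) = phi (X_i^q x) with X_i^q phi x = M^q phi x. *)
Lemma local_rule_identity (S : {fset 'rV[int]_d}) (A : 'rV[int]_d -> perp P) :
  (msupp L `<=` S)%fset -> (msupp M `<=` S)%fset ->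
  {in S, forall m : 'rV[int]_d, m 0 i = 0} ->
  h (\sum_(m <- S) const L@_m *: A m) = \sum_(m <- S) M@_m * h (A m).
Proof.
move=> LS MS S0.
have [k _ sep] := near_separated S W (prime_gt1 p_prime).
move: {sep} (sep k (leqnn k)) => /= sep.
set q := (p ^ k)%N in sep.
(* On the window W - q m the pattern y is the translate of A m; these windows
   being disjoint, at most one term of the sum is present. *)
pose y : series p d := fun n =>
  \sum_(m <- S | n + m *+ q \in W) val (A m) (n + m *+ q).
have [|x xP xy] := @perp_extend p d i L
    [seq w - m *+ q | m <- S, w <- W] y p_prime L0 Lfree.
  move=> _ /allpairsP[[m w] [mS wW ->]] /=.
  by rewrite !mxE mulmxnE W0 // S0 // mul0rn subr0.
pose X : perp P := exist _ x (mem_set xP).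
have XA m : m \in S -> {in W, val (monomial p (m *+ q) *: X) =1 val (A m)}.
  move=> mS w wW; rewrite val_scale scale_monomialE /= xy; last first.
    exact: allpairs_f.
  rewrite /y big_mkcond (big_fsetD1 m) //= subrK wW big1_fset ?addr0 // => m'.
  rewrite !inE => /andP[m'm m'S] _; case: ifP => // inW; case/eqP: m'm.
  by apply/esym; apply: (sep m mS m' m'S w wW _ inW); rewrite addrK.
have hXA m : m \in S -> h (monomial p (m *+ q) *: X) = h (A m).
  by move=> mS; apply: phiW; apply: XA.
have XL : monomial p (e *+ q) *: X = L ^+ q *: X.
  by apply: val_inj; rewrite !val_scale; apply: perp_automatonX.
have hL : h (\sum_(m <- S) const L@_m *: A m) = h (L ^+ q *: X).
  apply: phiW => w wW; rewrite val_sum val_scale.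
  rewrite (scale_frobeniusE p_prime _ _ _ LS); apply: eq_big_seq => m mS.
  by rewrite val_scale scale_constE -XA // val_scale scale_monomialE.
rewrite hL -XL {1}/h phiM val_scale.
rewrite (perp_automatonX _ (set_mem (valP (phi X)))).
rewrite (scale_frobeniusE p_prime _ _ _ MS); apply: eq_big_seq => m mS.
by rewrite -hXA // /h phiM val_scale scale_monomialE.
Qed.

Local Notation S := (msupp L `|` msupp M)%fset.

Lemma supports_free : {in S, forall m : 'rV[int]_d, m 0 i = 0}.
Proof. by move=> m; rewrite inE => /orP[/Lfree|/Mfree]. Qed.

Lemma local_rule_sum (A : 'rV[int]_d -> perp P) :
  h (\sum_(m <- S) const L@_m *: A m) = \sum_(m <- S) M@_m * h (A m).
Proof.
exact: local_rule_identity (fsubsetUl _ _) (fsubsetUr _ _) supports_free.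
Qed.

Lemma local_rule0 : h 0 = 0.
Proof. by rewrite /h phi0 raddf0. Qed.

Lemma local_rule_coef m X : m \in S -> h (const L@_m *: X) = M@_m * h X.
Proof.
move=> mS; have := local_rule_sum (fun m' => if m' == m then X else 0).
rewrite !(big_fsetD1 m mS) //= eqxx !big1_fset ?addr0 // => m'.
  by rewrite !inE => /andP[/negPf-> _] _; rewrite local_rule0 mulr0.
by rewrite !inE => /andP[/negPf-> _] _; rewrite scaler0.
Qed.

Lemma const_laurentM c c' : const (c * c') = const c * const c'.
Proof. by rewrite /const laurent_termM addr0. Qed.

Lemma const_laurent_div c (X : perp P) : c != 0 -> exists Y, X = const c *: Y.
Proof.
move=> c0; exists (const c^-1 *: X); rewrite scalerA -const_laurentM divff //.
by apply/esym/scale1r.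
Qed.

(** Feed X / L_m1 and Y / L_m2 to the identity at two distinct points m1 and m2
    of the support of L. *)
Lemma local_ruleD (X Y : perp P) : (1 < #|` msupp L|)%N -> h (X + Y) = h X + h Y.
Proof.
move=> L_terms.
have /fset0Pn[m1 m1L] : msupp L != fset0.
  by rewrite -cardfs_gt0; apply: leq_trans L_terms.
have /fset0Pn[m2] : (msupp L `\ m1)%fset != fset0.
  by rewrite -cardfs_gt0; move: L_terms; rewrite (cardfsD1 m1) m1L.
rewrite !inE => /andP[m21 m2L].
have [|X' ->] := @const_laurent_div L@_m1 X; first by rewrite mcoeff_neq0.
have [|Y' ->] := @const_laurent_div L@_m2 Y; first by rewrite mcoeff_neq0.
have m1S : m1 \in S by rewrite inE m1L.
have m2S : m2 \in S by rewrite inE m2L.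
pose A m := if m == m1 then X'
  else if m == m2 then Y' else 0.
have A1 : A m1 = X' by rewrite /A eqxx.
have A2 : A m2 = Y' by rewrite /A (negPf m21) eqxx.
have A0 m : m \in ((S `\ m1) `\ m2)%fset -> A m = 0.
  by rewrite !inE /A => /and3P[/negPf-> /negPf-> _].
have m2S' : m2 \in (S `\ m1)%fset by rewrite in_fsetD1 m21.
have := local_rule_sum A.
rewrite 2!(big_fsetD1 m1 m1S) 2!(big_fsetD1 m2 m2S') /=.
rewrite !big_seq !big1 => [|m /A0->|m /A0->]; last 2 first.
- by rewrite local_rule0 mulr0.
- by rewrite scaler0.
rewrite !addr0 A1 A2 -(local_rule_coef _ m1S) -(local_rule_coef _ m2S).
exact: id.
Qed.

Hypothesis L_terms : (1 < #|` msupp L|)%N.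

Lemma hom_evalE X n : val (phi X) n = h (monomial p (v - n) *: X).
Proof. by rewrite /h phiM val_scale scale_monomialE opprB addrC subrK. Qed.

Lemma hom_additive (X Y : perp P) : phi (X + Y) = phi X + phi Y.
Proof.
apply/val_inj/funext => n; rewrite hom_evalE scalerDr local_ruleD //.
by rewrite -!hom_evalE.
Qed.

(** A scalar in F_p is a natural multiple of 1, so additivity suffices. *)
Lemma hom_const (c : 'F_p) (X : perp P) : phi (const c *: X) = const c *: phi X.
Proof.
have -> : const c = 1 *+ c.
  by rewrite /const -[1]/(<< 1 *g 0 >> : laurent p d) -monalgUMn natr_Zp.
rewrite -!scalerMnl !scale1r; elim: (c : nat) => [|k IH]; first by rewrite !mulr0n phi0.
by rewrite !mulrS hom_additive IH.
Qed.

Lemma hom_linear : linear phi.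
Proof.
move=> f X Y; rewrite hom_additive; congr (_ + _).
rewrite [f]monalgE !scaler_suml.
elim: (enum_fset (msupp f)) => [|m r IH]; first by rewrite !big_nil phi0.
rewrite !big_cons hom_additive IH; congr (_ + _).
have -> : (<< f@_m *g m >> : laurent p d) = const f@_m * monomial p m.
  by rewrite /const /monomial laurent_termM mulr1 add0r.
by rewrite -!scalerA hom_const phiM.
Qed.

Lemma rigid_eq X : phi X != 0 -> L = M.
Proof.
move=> phiX; have [n hX] : exists n, val (phi X) n != 0.
  apply: contrapT => H; move/eqP: phiX; apply; apply/val_inj/funext => n.
  by apply/eqP/negPn/negP => Xn; apply: H; exists n.
move: hX; rewrite hom_evalE; set Y := _ *: X => hY.
apply/malgP => m; have [mS|] := boolP (m \in S); last first.
  by rewrite inE negb_or => /andP[mL mM]; rewrite !mcoeff_outdom.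
have := local_rule_coef Y mS.
by rewrite /h hom_const val_scale scale_constE => /(mulIf hY).
Qed.

End Rigidity.

(** * Polynomials in the first variables *)

Lemma lift_exponent_inj d : injective (@lift_exponent d).
Proof.
move=> k l kl; apply/rowP => j; have /rowP/(_ (lift ord_max j)) := kl.
by rewrite !mxE liftK.
Qed.

Lemma mcoeff_lift p d (Phi : laurent p d) n :
  (lift_laurent Phi)@_n =
  \sum_(k <- msupp Phi) Phi@_k *+ (lift_exponent k == n).
Proof.
by rewrite /lift_laurent raddf_sum /=; apply: eq_bigr => k _; rewrite mcoeffU.
Qed.

Lemma lift_free p d (Phi : laurent p d) : free_of ord_max (lift_laurent Phi).
Proof.
move=> n; rewrite -mcoeff_neq0 mcoeff_lift => n_neq0.
have [k <-] : exists k, lift_exponent k = n.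
  apply: contrapT => H; case/eqP: n_neq0; apply: big1 => k _.
  by case: eqP => // kn; case: H; exists k.
by rewrite mxE unlift_none.
Qed.

Lemma lift_terms p d (Phi : laurent p d) :
  at_least_two_terms Phi -> at_least_two_terms (lift_laurent Phi).
Proof.
rewrite /at_least_two_terms => /leq_trans; apply.
have <- : #|` [fset lift_exponent k | k in msupp Phi]%fset| = #|` msupp Phi|.
  by rewrite card_imfset //; exact: lift_exponent_inj.
apply: fsubset_leq_card; apply/fsubsetP => _ /imfsetP[k /= kPhi ->].
rewrite -mcoeff_neq0 mcoeff_lift (big_fsetD1 k) //= eqxx mulr1n big1_fset.
  by rewrite addr0 mcoeff_neq0.
by move=> l; rewrite !inE (inj_eq (@lift_exponent_inj d)) => /andP[/negPf->].
Qed.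

Lemma two_terms_neq0 p d (L : laurent p d) : at_least_two_terms L -> L != 0.
Proof. by apply: contraTneq => ->; rewrite /at_least_two_terms msupp0 cardfs0. Qed.

(** * Rigidity of continuous maps *)

Section Continuous.
Context (p d : nat) (p_prime : prime p) (i : 'I_d) (L M : laurent p d).
Hypotheses (Lfree : free_of i L) (Mfree : free_of i M).
Hypothesis L_terms : at_least_two_terms L.
Context (phi : perp (automaton i L) -> perp (automaton i M)).
Hypotheses (phiC : continuous phi) (phiS : forall j, {morph phi : x / shift j x}).

(** The map phi need not fix 0; [phi'] does. *)
Let phi' X := phi X - phi 0.

Lemma centered_rigidity : linear phi' /\ forall X, phi' X != 0 -> L = M.
Proof.
have phiM := shift_monomial phiS.
have phi'M m : {morph phi' : x / monomial p m *: x}.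
  by move=> X; rewrite /phi' scalerBr -!phiM scaler0.
have phi'0 : phi' 0 = 0 by rewrite /phi' subrr.
have [v [W [W0 phiW]]] := continuous_local Lfree phiC phiM.
have phi'W : local_at phi' v W.
  move=> X Y XY; rewrite /phi' !raddfB /=.
  by rewrite !series_addE (phiW X Y XY).
have L0 := two_terms_neq0 L_terms.
split; first by apply: (hom_linear p_prime Lfree Mfree L0 phi'M phi'0 W0 phi'W L_terms).
exact: (rigid_eq p_prime Lfree Mfree L0 phi'M phi'0 W0 phi'W L_terms).
Qed.

Lemma linear_rigidity : phi 0 = 0 -> linear phi.
Proof.
move=> phi0; have -> : phi = phi'; last exact: (proj1 centered_rigidity).
by apply/funext => X; rewrite /phi' phi0 subr0.
Qed.

Lemma perp_neq0 : exists X : perp (automaton i L), X != 0.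
Proof.
have [|x xL x1] := perp_extend (D := [:: 0]) (fun=> 1) p_prime (two_terms_neq0 L_terms) Lfree.
  by move=> n; rewrite inE => /eqP->; rewrite mxE.
exists (exist _ x (mem_set xL)); apply/eqP => /(congr1 val) /= x0.
have := x1 0 (mem_head _ _); rewrite x0 => /eqP.
by rewrite eq_sym oner_eq0.
Qed.

Lemma injective_rigidity : injective phi -> L = M.
Proof.
have [X X0] := perp_neq0; move=> phi_inj.
by apply: (proj2 centered_rigidity X); rewrite subr_eq0 (inj_eq phi_inj).
Qed.

End Continuous.

(** The polynomials may differ, so the identity has to be transported between
    two distinct types. *)
Lemma perp_eq_isomorphic p d (f g : laurent p d) :
  perp f = perp g -> topologically_isomorphic f g.
Proof.
move=> fg.
pose cast (f' g' : laurent p d) (E : perp f' = perp g') (X : perp f') : perp g' :=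
  exist _ (val X) (eq_ind _ (fun A : set (series p d) => val X \in A) (valP X) _ E).
have castC f' g' E : continuous (@cast f' g' E).
  move=> X A /cylinder_nbhs_perp[D DA].
  by apply: filterS (nbhs_cylinder_perp X D) => Y YX; apply: DA.
exists (cast f g fg), (cast g f (esym fg)); split => //.
- by move=> X; apply: val_inj.
- by move=> X; apply: val_inj.
- by move=> j X; apply: val_inj; rewrite -[LHS]/(val (shift j X)) /shift !val_scale.
Qed.

Theorem theorem13 (p d : nat) (p_prime : prime p) (d_ge2 : (2 <= d.+1)%N)
    (Phi Psi : laurent p d)
    (Phi_terms : at_least_two_terms Phi)
    (Psi_terms : at_least_two_terms Psi) :
  (forall phi : perp (ca_poly Phi) -> perp (ca_poly Psi),
     topological_homomorphism phi -> algebraic_homomorphism phi) /\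
  (topologically_isomorphic (ca_poly Phi) (ca_poly Psi) <->
     perp (ca_poly Phi) = perp (ca_poly Psi)).
Proof.
have L_terms := lift_terms Phi_terms.
have Lfree := @lift_free p d Phi; have Mfree := @lift_free p d Psi.
split=> [phi [[phiS phi0] phiC]|].
  split=> //.
  exact: (linear_rigidity p_prime Lfree Mfree L_terms phiC phiS phi0).
split; last exact: perp_eq_isomorphic.
move=> [phi [psi [phiK _ phiC _ phiS]]].
have LM : lift_laurent Phi = lift_laurent Psi.
  exact: (injective_rigidity p_prime Lfree Mfree L_terms phiC phiS (can_inj phiK)).
by rewrite /ca_poly LM.
Qed.
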